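(* For every $n\ge0$ the map $\gamma\mapsto(\gamma(0),\gamma'(0))$ induces an isomorphism $T\mathbb{R}^n\cong\mathbb{R}^n\times\mathbb{R}^n$ in $\mathbf{SSS}$, under which $T_x\mathbb{R}^n\cong\mathbb{R}^n$ for every $x\in\mathbb{R}^n$, and for $f\in\mathbf{SSS}(\mathbb{R}^m,\mathbb{R}^n)=C^\infty(\mathbb{R}^m,\mathbb{R}^n)$ the map $Tf$ becomes $$Tf(x,v)=(f(x),\ Df(x)v),$$ with $Df$ the Jacobian. In particular $Df:\mathbb{R}^m\to\mathbb{R}^{n\times m}$ is sample-smooth, and all higher derivatives are obtained by iterating $T$.
   Context: **Sample space.** $\Omega=[0,1]^{\mathbb{N}}$; $\mathcal{B}_\Omega$ is the universal completion of its Borel (product) $\sigma$-algebra, i.e. all universally measurable subsets; $\Omega^\Omega$ is the set of all $\mathcal{B}_\Omega$-$\mathcal{B}_\Omega$-measurable self-maps of $\Omega$. **Site.** $\Omega_n:=\mathbb{R}^n\times\Omega$, $n\ge0$. A map $g:\Omega_m\to\mathbb{R}^n$ is mixed-smooth, $g\in\mathcal{C}^\infty_{\mathrm{mix}}(\Omega_m,\mathbb{R}^n)$, if (M1) $g(-,\omega)\in C^\infty(\mathbb{R}^m,\mathbb{R}^n)$ for every $\omega$, and (M2) $g(t,-)$ is $\mathcal{B}_\Omega$-Borel measurable for every $t$. The category $\mathbb{S}$ has objects $\Omega_n$ and morphisms $\mathbb{S}(\Omega_m,\Omega_n)=\{(g,\Phi): g\in\mathcal{C}^\infty_{\mathrm{mix}}(\Omega_m,\mathbb{R}^n),\Phi\in\Omega^\Omega\}$,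 where $(g,\Phi)(t,\omega)=(g(t,\omega),\Phi(\omega))$. **Sample-smooth spaces.** A sample-smooth space is a set $\mathcal{X}$ with, for each $n\ge0$, a set $\mathcal{X}^{\Omega_n}$ of maps $\Omega_n\to\mathcal{X}$ (plots) containing all constant maps and such that $p\in\mathcal{X}^{\Omega_n}$, $h\in\mathbb{S}(\Omega_m,\Omega_n)$ imply $p\circ h\in\mathcal{X}^{\Omega_m}$. A map $f:\mathcal{X}\to\mathcal{Y}$ is sample-smooth (a morphism of $\mathbf{SSS}$) if $f\circ p\in\mathcal{Y}^{\Omega_n}$ for all $n$ and $p\in\mathcal{X}^{\Omega_n}$. Products: $(\prod_i\mathcal{X}_i)^{\Omega_n}=\prod_i\mathcal{X}_i^{\Omega_n}$. $\mathbb{R}^k$ carries the plots $\mathcal{C}^\infty_{\mathrm{mix}}(\Omega_n,\mathbb{R}^k)$, and $\mathbf{SSS}(\mathbb{R}^k,\mathbb{R}^l)=C^\infty(\mathbb{R}^k,\mathbb{R}^l)$. Subsets carry the plots of the ambient space with values in them. For a surjection $q:\mathcal{X}\to\mathcal{Q}$ the quotient structure is $\mathcal{Q}^{\Omega_n}=\{\text{constants}\}\cup q\circ\mathcal{X}^{\Omega_n}$. The function space $\mathcal{Y}^{\mathcal{X}}$ is $\mathbf{SSS}(\mathcal{X},\mathcal{Y})$ with plots those $F:\Omega_n\to\mathcal{Y}^{\mathcal{X}}$ such that for all $m$, $h\in\mathbb{S}(\Omega_m,\Omega_n)$, $q\in\mathcal{X}^{\Omega_m}$ one has $(u\mapsto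 F(h(u))(q(u)))\in\mathcal{Y}^{\Omega_m}$. **Tangent bundle.** On the function space $\mathcal{X}^{\mathbb{R}}$ let $\gamma\sim\eta$ iff $\gamma(0)=\eta(0)$ and $(f\circ\gamma)'(0)=(f\circ\eta)'(0)$ for all $f\in\mathbf{SSS}(\mathcal{X},\mathbb{R})$. $T\mathcal{X}:=\mathcal{X}^{\mathbb{R}}/\!\sim$ with the quotient structure, $\pi_{\mathcal{X}}:T\mathcal{X}\to\mathcal{X}$, $[\gamma]\mapsto\gamma(0)$, and $T_x\mathcal{X}:=\pi_{\mathcal{X}}^{-1}(x)$ with the subspace structure. For $f:\mathcal{X}\to\mathcal{Y}$ sample-smooth, $Tf[\gamma]:=[f\circ\gamma]$. *)

(* Defs.v *)
From HB Require Import structures.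
From mathcomp Require Import all_boot all_order all_algebra.
From mathcomp Require Import all_classical all_reals all_analysis.

Set Implicit Arguments.
Unset Strict Implicit.
Unset Printing Implicit Defensive.

Import Order.TTheory GRing.Theory Num.Theory.
Import numFieldNormedType.Exports.

Local Open Scope classical_set_scope.
Local Open Scope ring_scope.

Definition Omega (R : realType) : Type :=
  {w : nat -> R | forall i, 0 <= w i <= 1}.

HB.instance Definition _ (R : realType) := gen_eqMixin (Omega R).
HB.instance Definition _ (R : realType) := gen_choiceMixin (Omega R).

Section sample_space.
Variable R : realType.

Lemma Omega_zero_proof (i : nat) : (0 : R) <= (fun=> 0) i <= (1 : R).
Proof. by rewrite lexx ler01. Qed.

HB.instance Definition _ :=
  isPointed.Build (Omega R) (exist _ _ Omega_zero_proof).

(* [0,1] is second countable, so these sets generate the Borel sigma-algebra of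
   the product topology. *)
Definition cylinders : set (set (Omega R)) :=
  [set A | exists (i : nat) (B : set R),
     open B /\ A = [set w | B (sval w i)]].

Definition borelOmega := g_sigma_algebraType cylinders.

(* A belongs to the completion of the Borel sets under every Borel probability
   measure, i.e. it differs from a Borel set by a null set. *)
Definition univ_measurable (A : set (Omega R)) : Prop :=
  forall P : probability borelOmega R,
  exists B : set borelOmega,
    measurable B /\ P.-negligible ((A `\` B) `|` (B `\` A)).

Lemma univ_measurable0 : univ_measurable set0.
Proof.
move=> P; exists set0; split; first exact: measurable0.
by rewrite !setD0 setU0; exact: negligible_set0.
Qed.

Lemma univ_measurableC (A : set (Omega R)) :
  univ_measurable A -> univ_measurable (~` A).
Proof.
move=> mA P; have [B [mB nAB]] := mA P.
exists (~` B); split; first exact: measurableC.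
apply: negligibleS nAB => w /= [[nAw /contrapT Bw]|[nBw /contrapT Aw]].
  by right.
by left.
Qed.

Lemma univ_measurable_bigcup (F : (set (Omega R))^nat) :
  (forall i, univ_measurable (F i)) -> univ_measurable (\bigcup_i F i).
Proof.
move=> mF P.
pose B i := sval (cid (mF i P)).
have BP i : measurable (B i) /\
    P.-negligible ((F i `\` B i) `|` (B i `\` F i)) by exact: (svalP (cid (mF i P))).
exists (\bigcup_i B i); split.
  by apply: bigcupT_measurable => i; case: (BP i).
have nD : P.-negligible (\bigcup_i ((F i `\` B i) `|` (B i `\` F i))).
  by apply: negligible_bigcup => i; case: (BP i).
apply: negligibleS nD.
move=> w /= [[[i _ Fiw] nB]|[[i _ Biw] nF]]; exists i => //.
  by left; split => // Biw; apply: nB; exists i.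
by right; split => // Fiw; apply: nF; exists i.
Qed.

End sample_space.

Definition univ_display : measure_display.
Proof. exact: default_measure_display. Qed.

HB.instance Definition _ (R : realType) :=
  @isMeasurable.Build univ_display (Omega R) (@univ_measurable R)
    (@univ_measurable0 R) (@univ_measurableC R) (@univ_measurable_bigcup R).

Section smooth.
Variables (R : realType) (m : nat) (V : normedModType R).

(* In finite dimension, "f is differentiable and its differential is C^k" amounts
   to "f is differentiable and each directional derivative of f is C^k". *)
Fixpoint Ck (k : nat) (f : 'rV[R]_m -> V) : Prop :=
  if k is k'.+1 then
    (forall x, differentiable f x) /\ (forall v, Ck k' ('D_v f))
  else continuous f.

Definition smooth (f : 'rV[R]_m -> V) : Prop := forall k, Ck k f.

End smooth.

Definition borel (R : realType) (V : normedModType R) :=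
  g_sigma_algebraType (@open V).

Definition mixed_smooth (R : realType) (m : nat) (V : normedModType R)
    (g : 'rV[R]_m * Omega R -> V) : Prop :=
  (forall w, smooth (fun t => g (t, w))) /\
  (forall t, measurable_fun [set: Omega R] (fun w => g (t, w) : borel V)).

Section smooth_theory.
Variable R : realType.

Lemma scale_is_bilinear (V : normedModType R) :
  bilinear_for
    (GRing.Scale.Law.clone _ _ *:%R _) (GRing.Scale.Law.clone _ _ *:%R _)
    (fun (a : R) (u : V) => a *: u).
Proof.
split=> [u'|u] a x y /=; first by rewrite scalerDl scalerA.
by rewrite scalerDr !scalerA mulrC.
Qed.

Lemma is_diff_scale (V W : normedModType R) (a : W -> R) (F : W -> V) x :
  differentiable a x -> differentiable F x ->
  is_diff x (fun y => a y *: F y) (fun y => a x *: 'd F x y + 'd a x y *: F x).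
Proof.
move=> da dF.
pose sM := bilinear_isBilinear.Build R R V V _ _ _ (@scale_is_bilinear V).
pose s : {bilinear R -> V -> V} := HB.pack (fun (a : R) (u : V) => a *: u) sM.
have sc : continuous (fun p : R * V => s p.1 p.2).
  by move=> p; exact: scale_continuous.
have dp := differentiable_pair da dF.
have ds := differentiable_bilin (a x, F x) sc.
have -> : (fun y => a y *: F y) = (fun p => s p.1 p.2) \o (fun y => (a y, F y)).
  by [].
apply: DiffDef; first exact: differentiable_comp.
by rewrite diff_comp// diff_pair// diff_bilin.
Qed.

Lemma Ck_cts (m k : nat) (V : normedModType R) (f : 'rV[R]_m -> V) :
  Ck k f -> continuous f.
Proof. by case: k => // k [df _] x; exact: differentiable_continuous. Qed.

Lemma CkS (m k : nat) (V : normedModType R) (f : 'rV[R]_m -> V) :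
  Ck k.+1 f -> Ck k f.
Proof.
elim: k f => [|k IH] f; first exact: Ck_cts.
by move=> [df dDf]; split => // v; exact: IH.
Qed.

Lemma Ck_cst (m k : nat) (V : normedModType R) (c : V) :
  Ck k (cst c : 'rV[R]_m -> V).
Proof.
elim: k c => [|k IH] c; first exact: cst_continuous.
split=> [x|v]; first exact: differentiable_cst.
rewrite (_ : 'D_v _ = cst 0); first exact: IH.
by apply/funext => x; exact: derive_cst.
Qed.

Lemma CkD (m k : nat) (V : normedModType R) (f g : 'rV[R]_m -> V) :
  Ck k f -> Ck k g -> Ck k (f + g).
Proof.
elim: k f g => [|k IH] f g; first by move=> cf cg x; apply: (@continuousD _ _ _ f g x); [exact: cf|exact: cg].
move=> [df Df] [dg Dg]; split=> [x|v]; first exact: differentiableD.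
rewrite (_ : 'D_v _ = 'D_v f + 'D_v g); first exact: IH (Df v) (Dg v).
by apply/funext => x; rewrite deriveD//; exact: diff_derivable.
Qed.

Lemma Ck_sum (m n k : nat) (V : normedModType R) (f : 'I_n -> 'rV[R]_m -> V) :
  (forall i, Ck k (f i)) -> Ck k (\sum_(i < n) f i).
Proof.
move=> Cf; elim/big_ind: _ => //; last by move=> ? ?; exact: CkD.
exact: Ck_cst.
Qed.

Lemma Ck_scale (m k : nat) (V : normedModType R) (a : 'rV[R]_m -> R)
    (F : 'rV[R]_m -> V) :
  Ck k a -> Ck k F -> Ck k (fun x => a x *: F x).
Proof.
elim: k a F => [|k IH] a F; first by move=> ca cF x; apply: (@continuousZ _ _ _ a F x); [exact: ca|exact: cF].
move=> Ca CF; have [da Da] := Ca; have [dF DF] := CF.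
have dd x := is_diff_scale (da x) (dF x).
split=> [x|v]; first by have [] := dd x.
rewrite (_ : 'D_v _ = (fun x => a x *: 'D_v F x) + (fun x => 'D_v a x *: F x)).
  by apply: CkD; [exact: IH (CkS Ca) (DF v)|exact: IH (Da v) (CkS CF)].
apply/funext => x; have [d1 d2] := dd x.
by rewrite deriveE// d2 /= fctE /= !deriveE.
Qed.

Lemma Ck_coord (m n k : nat) (g : 'rV[R]_m -> 'rV[R]_n) i :
  Ck k g -> Ck k (fun x => g x 0 i).
Proof.
elim: k g => [|k IH] g.
  move=> cg x.
  apply: (@continuous_comp _ _ _ g (fun M : 'rV[R]_n => M 0 i) x).
    exact: cg.
  exact: coord_continuous.
move=> [dg Dg]; split=> [x|v].
  exact: differentiable_comp (dg x) (differentiable_coord (g x) 0 i).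
rewrite (_ : 'D_v _ = (fun x => 'D_v g x 0 i)); first exact: IH (Dg v).
apply/funext => x; rewrite (derive_mx (M := g)) ?mxE//.
exact: diff_derivable.
Qed.

Lemma Ck_comp (m n k : nat) (V : normedModType R) (f : 'rV[R]_n -> V)
    (g : 'rV[R]_m -> 'rV[R]_n) :
  Ck k f -> Ck k g -> Ck k (f \o g).
Proof.
elim: k f => [|k IH] f.
  move=> cf cg x; apply: (@continuous_comp _ _ _ g f x); first exact: cg.
  exact: cf.
move=> [df Df] Cg; have [dg Dg] := Cg; split=> [x|v].
  exact: differentiable_comp.
rewrite (_ : 'D_v _ = \sum_(i < n)
    (fun x => 'D_v g x 0 i *: ('D_(delta_mx 0 i) f \o g) x)).
  apply: Ck_sum => i; apply: Ck_scale; first exact: Ck_coord (Dg v).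
  exact: IH (Df _) (CkS Cg).
apply/funext => x; rewrite fct_sumE deriveE; last exact: differentiable_comp.
rewrite diff_comp//= [in LHS](row_sum_delta ('d g x v)) linear_sum.
by apply: eq_bigr => i _; rewrite linearZ /= !deriveE.
Qed.

Lemma smooth_comp (m n : nat) (V : normedModType R) (f : 'rV[R]_n -> V)
    (g : 'rV[R]_m -> 'rV[R]_n) :
  smooth f -> smooth g -> smooth (f \o g).
Proof. by move=> sf sg k; exact: Ck_comp. Qed.

End smooth_theory.

Section borel_theory.
Variable R : realType.

Lemma borel_open (V : normedModType R) (U : set V) :
  open U -> measurable (U : set (borel V)).
Proof. exact: sub_gen_smallest. Qed.

Lemma measurable_to_borel d (T : measurableType d) (V : normedModType R)
    (f : T -> V) :
  (forall U : set V, open U -> measurable (f @^-1` U)) ->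
  measurable_fun [set: T] (f : T -> borel V).
Proof.
move=> mf; apply: (@measurability _ _ T (borel V) _ _ (@open V)) => //.
by move=> _ [U oU <-]; rewrite setTI; exact: mf.
Qed.

Lemma measurable_borel_preimage d (T : measurableType d) (V : normedModType R)
    (f : T -> V) (U : set V) :
  measurable_fun [set: T] (f : T -> borel V) -> open U ->
  measurable (f @^-1` U).
Proof.
by move=> mf oU; rewrite -[X in measurable X]setTI; apply: mf => //;
  exact: borel_open.
Qed.

Lemma continuous_measurable_borel (V W : normedModType R) (f : V -> W) :
  continuous f -> measurable_fun [set: borel V] (f : borel V -> borel W).
Proof.
move=> cf; apply: measurable_to_borel => U oU.
by apply: borel_open; move/continuousP : cf; exact.
Qed.

(* The grid of mesh 1/(k+1) below x. *)
Definition grid (n k : nat) (x : 'rV[R]_n) : 'rV[int]_n :=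
  \row_i Num.floor (x 0 i * k.+1%:R).

Definition of_grid (n k : nat) (z : 'rV[int]_n) : 'rV[R]_n :=
  \row_i ((z 0 i)%:~R / k.+1%:R).

Lemma of_gridK_lt (n k : nat) (x : 'rV[R]_n) (e : R) :
  k.+1%:R^-1 < e -> ball x e (of_grid k (grid k x)).
Proof.
move=> ke; have k0 : (0 : R) < k.+1%:R^-1 by rewrite invr_gt0 ltr0n.
split; first exact: lt_trans ke.
move=> i j; rewrite ord1 !mxE /ball /= /ball_.
have kn0 : k.+1%:R != 0 :> R by rewrite pnatr_eq0.
have /andP[l u] := floor_itv (x 0 j * k.+1%:R).
apply: le_lt_trans ke.
rewrite -[X in X - _](mulfK kn0) -mulrBl normrM ger0_norm ?subr_ge0//.
rewrite (gtr0_norm k0) ger_pMl// lerBlDr ltW//.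
by rewrite addrC -[1]/(1%:~R) -intrD.
Qed.

Lemma measurable_grid (n k : nat) (z : 'rV[int]_n) :
  measurable ([set x | grid k x = z] : set (borel 'rV[R]_n)).
Proof.
pose y (i : 'I_n) (x : 'rV[R]_n) : R := x 0 i * k.+1%:R.
have cy i : continuous (y i).
  move=> x.
  apply: (@continuousM R 'rV[R]_n (fun x => x 0 i) (fun=> k.+1%:R) x).
    exact: coord_continuous.
  exact: cst_continuous.
have mlt i c : measurable ([set x | y i x < c] : set (borel 'rV[R]_n)).
  apply: borel_open; rewrite (_ : [set _ | _] = y i @^-1` [set r | r < c])//.
  by move/continuousP : (cy i); apply; exact: open_lt.
rewrite (_ : [set _ | _] = \bigcap_(i in [set: 'I_n])
    (~` [set x | y i x < (z 0 i)%:~R] `&` [set x | y i x < (z 0 i + 1)%:~R])).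
  apply: fin_bigcap_measurable; first exact: finite_finset.
  move=> i _; apply: measurableI; last exact: mlt.
  by apply: measurableC; exact: mlt.
apply/seteqP; split=> x /=.
  move=> <- i _ /=; have := floor_itv (y i x).
  rewrite !mxE -/(y i x) => /andP[l u]; split=> //.
  by apply/negP; rewrite -leNgt.
move=> xz; apply/rowP => i; rewrite mxE -/(y i x).
have [/negP l u] := xz i I; apply: floor_def.
by rewrite leNgt l u.
Qed.

Lemma measurable_caratheodory d (T : measurableType d) (n : nat)
    (V : normedModType R) (p : 'rV[R]_n * T -> V) (g : T -> 'rV[R]_n) :
  (forall w, continuous (fun x => p (x, w))) ->
  (forall x, measurable_fun [set: T] (fun w => p (x, w) : borel V)) ->
  measurable_fun [set: T] (g : T -> borel 'rV[R]_n) ->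
  measurable_fun [set: T] (fun w => p (g w, w) : borel V).
Proof.
move=> cp mp mg; apply: measurable_to_borel => U oU.
pose q k w := p (of_grid k (grid k (g w)), w).
have mq k (B : set (borel V)) : measurable B -> measurable (q k @^-1` B).
  move=> mB.
  rewrite (_ : _ @^-1` _ = \bigcup_(z in [set: 'rV[int]_n])
    (g @^-1` [set x | grid k x = z] `&`
     (fun w => p (of_grid k z, w)) @^-1` B)).
    apply: countable_bigcupT_measurable; first exact: countableP.
    move=> z; apply: measurableI.
      by rewrite -[X in measurable X]setTI; apply: mg => //;
        exact: measurable_grid.
    by rewrite -[X in measurable X]setTI; exact: mp.
  apply/seteqP; split=> w /=; first by exists (grid k (g w)).
  by move=> [z _ [/= gz]]; rewrite /q gz.
pose S j := [set v : V | ball v j.+1%:R^-1 `<=` U].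
have mS j : measurable (S j : set (borel V)).
  rewrite -[S j]setCK; apply: measurableC; apply: borel_open.
  rewrite (_ : ~` S j = \bigcup_(z in ~` U) ball z j.+1%:R^-1).
    by apply: bigcup_open => z _; exact: ball_open.
  apply/seteqP; split=> v /=.
    by move/existsNP => [z /not_implyP[vz Uz]]; exists z => //; exact: ball_sym.
  by move=> [z Uz vz] Sv; apply: Uz; apply: Sv; exact: ball_sym.
rewrite (_ : _ @^-1` _ = \bigcup_j \bigcup_N \bigcap_(k in [set k | (N <= k)%N])
    (q k @^-1` S j)).
  apply: bigcupT_measurable => j; apply: bigcupT_measurable => N.
  by apply: bigcap_measurableType => k _; exact: mq.
have qp w : q ^~ w @ \oo --> p (g w, w).
  apply: (@cvg_comp _ _ _ (fun k => of_grid k (grid k (g w)))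
    (fun x => p (x, w)) _ (nbhs (g w))); last exact: cp.
  apply/cvg_ballP => e e0.
  have := near_infty_natSinv_lt (PosNum e0); apply: filterS => k /=.
  exact: of_gridK_lt.
apply/seteqP; split=> w /=.
  move=> Upw; have /nbhs_ballP[e /= e0 eU] : nbhs (p (g w, w)) U.
    by apply: open_nbhs_nbhs.
  have [j _ /(_ j (leqnn _)) /= je] := near_infty_natSinv_lt (PosNum (divr_gt0 e0 (ltr0n R 2))).
  exists j => //.
  have /cvg_ballP /(_ j.+1%:R^-1) := qp w.
  rewrite invr_gt0 ltr0n => /(_ isT)[N _ NP].
  exists N => // k /= Nk v /= qv; apply: eU.
  apply: le_ball (ball_triangle (NP k Nk) qv).
  by rewrite (splitr e) lerD// ltW.
move=> [j _ [N _ NP]].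
have /cvg_ballP /(_ j.+1%:R^-1) := qp w.
rewrite invr_gt0 ltr0n => /(_ isT)[M _ MP].
apply: (NP (maxn N M)); first by rewrite /= leq_maxl.
by apply: ball_sym; apply: MP; rewrite /= leq_maxr.
Qed.

End borel_theory.

Definition site (R : realType) (n : nat) : Type := ('rV[R]_n * Omega R)%type.

(* A morphism (g, Phi) is identified with the map it induces. *)
Definition site_mor (R : realType) (m n : nat) (h : site R m -> site R n)
    : Prop :=
  exists (g : site R m -> 'rV[R]_n) (Phi : Omega R -> Omega R),
    [/\ mixed_smooth g, measurable_fun [set: Omega R] Phi
      & h = (fun u => (g u, Phi u.2))].

Section site_theory.
Variable R : realType.

Lemma mixed_smooth_cst (m : nat) (V : normedModType R) (c : V) :
  mixed_smooth (fun _ : 'rV[R]_m * Omega R => c).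
Proof.
split=> [w k|t]; first exact: Ck_cst.
exact: measurable_cst.
Qed.

Lemma mixed_smooth_site (m n : nat) (V : normedModType R)
    (p : site R n -> V) (h : site R m -> site R n) :
  mixed_smooth p -> site_mor h -> mixed_smooth (p \o h).
Proof.
move=> [sp mp] [g [Phi [[sg mg] mPhi ->]]]; split=> [w|t].
  exact: (smooth_comp (sp (Phi w)) (sg w)).
apply: (measurable_caratheodory (p := fun u => p (u.1, Phi u.2))
  (g := fun w => g (t, w))).
- by move=> w; exact: Ck_cts (sp (Phi w) 0%N).
- by move=> x; exact: measurableT_comp (mp x) mPhi.
- exact: mg.
Qed.

Lemma site_mor_comp (l m n : nat) (h : site R m -> site R n)
    (h' : site R l -> site R m) :
  site_mor h -> site_mor h' -> site_mor (h \o h').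
Proof.
move=> [g [Phi [sg mPhi ->]]] sh'.
have [g' [Phi' [_ mPhi' h'E]]] := sh'.
exists (g \o h'), (Phi \o Phi'); split; first exact: mixed_smooth_site.
  exact: measurableT_comp.
by apply/funext => u; rewrite h'E.
Qed.

End site_theory.

Record sss (R : realType) : Type := SSS {
  carrier :> Type;
  plot : forall n : nat, set (site R n -> carrier);
  plot_cst : forall (n : nat) (x : carrier), @plot n (fun=> x);
  plot_site : forall (m n : nat) (p : site R n -> carrier)
    (h : site R m -> site R n),
    @plot n p -> site_mor h -> @plot m (p \o h)
}.

Arguments plot {R} s n _.

Definition sample_smooth (R : realType) (X Y : sss R) (f : X -> Y) : Prop :=
  forall (n : nat) (p : site R n -> X), plot X n p -> plot Y n (f \o p).

Record sss_mor (R : realType) (X Y : sss R) : Type := SSSMor {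
  sss_fun :> X -> Y;
  sss_funP : sample_smooth sss_fun
}.

Definition is_iso (R : realType) (X Y : sss R) (f : sss_mor X Y) : Prop :=
  exists g : sss_mor Y X, cancel f g /\ cancel g f.

Section constructions.
Variable R : realType.
Implicit Types X Y Z : sss R.

Lemma sss_mor_ext X Y (f g : sss_mor X Y) : f =1 g -> f = g.
Proof.
case: f g => [f Pf] [g Pg] /= /funext fg; rewrite fg in Pf *.
by congr SSSMor; exact: Prop_irrelevance.
Qed.

Lemma sample_smooth_comp X Y Z (g : Y -> Z) (f : X -> Y) :
  sample_smooth g -> sample_smooth f -> sample_smooth (g \o f).
Proof. by move=> sg sf n p Xp; exact: sg (sf _ _ Xp). Qed.

Definition sss_comp X Y Z (g : sss_mor Y Z) (f : sss_mor X Y) : sss_mor X Z :=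
  SSSMor (sample_smooth_comp (sss_funP g) (sss_funP f)).

(* Meant for finite-dimensional V: R^o, row vectors and matrices. *)
Definition euclid (V : normedModType R) : sss R :=
  @SSS R V (fun n => @mixed_smooth R n V)
    (fun n => @mixed_smooth_cst R n V) (fun m n => @mixed_smooth_site R m n V).

Section product.
Variables X Y : sss R.

Let prod_plot n : set (site R n -> X * Y) :=
  [set p | plot X n (fst \o p) /\ plot Y n (snd \o p)].

Let prod_plot_cst n (x : X * Y) : prod_plot (fun _ : site R n => x).
Proof. by split; exact: plot_cst. Qed.

Let prod_plot_site m n (p : site R n -> X * Y) (h : site R m -> site R n) :
  prod_plot p -> site_mor h -> prod_plot (p \o h).
Proof.
by move=> [p1 p2] sh; split; [exact: plot_site p1 sh|exact: plot_site p2 sh].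
Qed.

Definition sss_prod : sss R := SSS prod_plot_cst prod_plot_site.

End product.

Section subspace.
Variables (X : sss R) (A : set X).

Let sub_plot n : set (site R n -> {x | A x}) :=
  [set p | plot X n (fun u => sval (p u))].

Let sub_plot_cst n (x : {x | A x}) : sub_plot (fun _ : site R n => x).
Proof. exact: plot_cst. Qed.

Let sub_plot_site m n (p : site R n -> {x | A x}) (h : site R m -> site R n) :
  sub_plot p -> site_mor h -> sub_plot (p \o h).
Proof. by move=> Xp sh; exact: (plot_site Xp sh). Qed.

Definition sss_sub : sss R := SSS sub_plot_cst sub_plot_site.

End subspace.

(* Meant for surjective q. *)
Section quotient.
Variables (X : sss R) (Q : Type) (q : X -> Q).

Let quot_plot n : set (site R n -> Q) :=
  [set r | (exists c : Q, r = fun=> c) \/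
           (exists2 p : site R n -> X, plot X n p & r = q \o p)].

Let quot_plot_cst n (c : Q) : quot_plot (fun _ : site R n => c).
Proof. by left; exists c. Qed.

Let quot_plot_site m n (r : site R n -> Q) (h : site R m -> site R n) :
  quot_plot r -> site_mor h -> quot_plot (r \o h).
Proof.
move=> [[c ->]|[p Xp ->]] sh; first by left; exists c.
by right; exists (p \o h) => //; exact: plot_site.
Qed.

Definition sss_quot : sss R := SSS quot_plot_cst quot_plot_site.

End quotient.

Section function_space.
Variables X Y : sss R.

Let fun_plot n : set (site R n -> sss_mor X Y) :=
  [set F | forall (m : nat) (h : site R m -> site R n) (q : site R m -> X),
     site_mor h -> plot X m q -> plot Y m (fun u => F (h u) (q u))].

Let fun_plot_cst n (f : sss_mor X Y) : fun_plot (fun _ : site R n => f).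
Proof. by move=> m h q _ Xq; exact: (sss_funP f Xq). Qed.

Let fun_plot_site m n (F : site R n -> sss_mor X Y)
    (h : site R m -> site R n) :
  fun_plot F -> site_mor h -> fun_plot (F \o h).
Proof.
by move=> YF sh l h' q sh' Xq; exact: (YF l (h \o h') q (site_mor_comp sh sh')).
Qed.

Definition sss_exp : sss R := SSS fun_plot_cst fun_plot_site.

End function_space.

End constructions.

Section tangent.
Variable R : realType.
Implicit Types X Y : sss R.

Definition line : sss R := euclid R^o.

Definition curve X : sss R := sss_exp line X.

Definition tangent_eq X (c d : curve X) : Prop :=
  c (0 : R) = d (0 : R) /\
  forall f : sss_mor X line,
    derive1 (fun t : R => f (c t) : R^o) 0 = derive1 (fun t : R => f (d t) : R^o) 0.

(* Equivalence classes, as sets of curves. *)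
Definition tvec X : Type :=
  {A : set (curve X) | exists c, A = tangent_eq c}.

Definition tvec_of X (c : curve X) : tvec X :=
  exist _ (tangent_eq c) (ex_intro _ c erefl).

Definition tangent X : sss R := sss_quot (@tvec_of X).

Definition tclass X (c : curve X) : tangent X := tvec_of c.

Definition trepr X (xi : tangent X) : curve X := sval (cid (svalP xi)).

(* Independent of the representative: see tprojE, and tmap_funE below. *)
Definition tproj X (xi : tangent X) : X := trepr xi (0 : R).

Definition tfiber X (x : X) : sss R :=
  sss_sub [set xi : tangent X | tproj xi = x].

Lemma tvec_ext X (xi eta : tvec X) : sval xi = sval eta -> xi = eta.
Proof.
case: xi eta => [A PA] [B PB] /= AB; rewrite -AB in PB *.
by congr exist; exact: Prop_irrelevance.
Qed.

Lemma tclass_eq X (c d : curve X) : tclass c = tclass d <-> tangent_eq c d.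
Proof.
split=> [[->]|[e0 e1]]; first by split.
apply: tvec_ext; apply/funext => b; apply/propext; split=> -[b0 b1].
  by split=> [|f]; [rewrite -e0|rewrite -e1].
by split=> [|f]; [rewrite e0|rewrite e1].
Qed.

Lemma treprK X (xi : tangent X) : tclass (trepr xi) = xi.
Proof.
by apply: tvec_ext => /=; rewrite -(svalP (cid (svalP xi))).
Qed.

Lemma tprojE X (c : curve X) : tproj (tclass c) = c (0 : R).
Proof. by have /tclass_eq[] := treprK (tclass c). Qed.

Section tangent_map.
Variables (X Y : sss R) (f : sss_mor X Y).

Definition tmap_fun (xi : tangent X) : tangent Y :=
  tclass (sss_comp f (trepr xi) : curve Y).

Lemma tmap_funE (c : curve X) :
  tmap_fun (tclass c) = tclass (sss_comp f c : curve Y).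
Proof.
apply/tclass_eq; have /tclass_eq[e0 e1] := treprK (tclass c).
by split=> [/=|g]; [rewrite e0|exact: (e1 (sss_comp g f))].
Qed.

Lemma tmap_fun_smooth : sample_smooth tmap_fun.
Proof.
move=> n r [[xi ->]|[p Xp ->]]; first by left; exists (tmap_fun xi).
right; exists (fun u => sss_comp f (p u) : curve Y).
  by move=> m h q sh Xq; exact: (sss_funP f (Xp m h q sh Xq)).
by apply/funext => u /=; rewrite tmap_funE.
Qed.

Definition tmap : sss_mor (tangent X) (tangent Y) := SSSMor tmap_fun_smooth.

End tangent_map.

Fixpoint iter_tangent (k : nat) (X : sss R) : sss R :=
  if k is k'.+1 then tangent (iter_tangent k' X) else X.

Fixpoint iter_tmap (k : nat) (X Y : sss R) (f : sss_mor X Y) :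
    sss_mor (iter_tangent k X) (iter_tangent k Y) :=
  if k is k'.+1 then tmap (iter_tmap k' f) else f.

End tangent.

Section euclidean.
Variable R : realType.

Definition Rn (n : nat) : sss R := euclid 'rV[R]_n.

Definition Mat (n m : nat) : sss R := euclid 'M[R]_(n, m).

(* The library Jacobian ['J f x] acts on row vectors on the right; its transpose
   has the partial derivative of the i-th component along the j-th coordinate as
   entry (i, j). *)
Definition Jac (m n : nat) (f : 'rV[R]_m -> 'rV[R]_n) (x : 'rV[R]_m)
    : 'M[R]_(n, m) := ('J f x)^T.

(* The dimension 2^k * n of the k-fold tangent bundle of R^n, in a form that
   makes T(R^d) = R^d * R^d = R^(d + d) hold without casts. *)
Fixpoint tdim (n k : nat) : nat :=
  if k is k'.+1 then (tdim n k' + tdim n k')%N else n.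

(* The vector u placed at a base point of the k-fold tangent bundle,
   with all other coordinates zero. *)
Fixpoint base_vec (n k : nat) (u : 'rV[R]_n) : 'rV[R]_(tdim n k) :=
  if k is k'.+1 then row_mx (base_vec k' u) 0 else u.

(* The point of the k-fold tangent bundle of R^n over x at which T^k f shows the
   k-th derivative of f at x in the directions v 0, ..., v (k - 1). *)
Fixpoint jet_point (n k : nat) (x : 'rV[R]_n) (v : nat -> 'rV[R]_n)
    : 'rV[R]_(tdim n k) :=
  if k is k'.+1 then row_mx (jet_point k' x v) (base_vec k' (v k')) else x.

(* The innermost fibre coordinate, where T^k f shows its k-th derivative. *)
Fixpoint top_part (n k : nat) : 'rV[R]_(tdim n k) -> 'rV[R]_n :=
  if k is k'.+1 then fun y => top_part (rsubmx y) else fun y => y.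

Fixpoint iter_derive (m n k : nat) (f : 'rV[R]_m -> 'rV[R]_n)
    (v : nat -> 'rV[R]_m) : 'rV[R]_m -> 'rV[R]_n :=
  if k is k'.+1 then 'D_(v k') (iter_derive k' f v) else f.

End euclidean.

(* Main.v *)
Require Import Defs.
From HB Require Import structures.
From mathcomp Require Import all_boot all_order all_algebra.
From mathcomp Require Import all_classical all_reals all_analysis.

Set Implicit Arguments.
Unset Strict Implicit.
Unset Printing Implicit Defensive.

Import Order.TTheory GRing.Theory Num.Theory.
Import numFieldNormedType.Exports.

Local Open Scope classical_set_scope.
Local Open Scope ring_scope.

(** A curve in R^n is C^oo, and by the chain rule the derivative at 0 of a
    smooth function along it depends only on its base point and its velocity;
    the coordinate functions recover both.  So [c] |-> (c(0), c'(0)) is a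
    well-defined injection T R^n -> R^n * R^n ([tangent_eqP]), and the straight
    curves t |-> x + t v give its inverse.

    The inverse preserves plots because sums and products of mixed-smooth maps
    are mixed-smooth.  For the map itself, a plot u |-> c_u of curves is uncurried:
    adding one real parameter s to the site, (u, s) |-> c_u(s) is mixed-smooth, and
    the velocity of c_u is its derivative in s at s = 0.  What remains is that
    a directional derivative of a mixed-smooth map is mixed-smooth
    ([mixed_smooth_derive]): smoothness in the Euclidean variable is clear, and
    measurability in the sample holds because the derivative is a pointwise
    limit of a sequence of difference quotients, each measurable.  All
    measurability of sums and products is drawn from the Caratheodory lemma
    [measurable_caratheodory], which avoids product Borel sigma-algebras.

    The formula for T f is the chain rule again ([tcoord_tmap]), and the
    Jacobian is smooth because its entries are partial derivatives of f.

    For the iterates, T^k f read in the charts is the map F_k with F_0 = f and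
    F_(k+1)(y, w) = (F_k(y), D_w F_k(y)) ([chart_iter_tmap]).  As a
    function of x, the jet point J_k(x) is affine, and moving x along u moves
    J_k(x) along the base vector of u, while the top part is linear; hence the
    top part of D_w F_k(J_k(x)), with w the base vector of v_k, is the derivative
    along v_k of x |-> top part of F_k(J_k(x)), which by induction is the k-th
    derivative of f ([prolong_jet_point]). *)

(** * Smooth maps *)

Section smooth_maps.
Variable R : realType.

(** A linear map on row vectors is the sum of its coordinate monomials
    x |-> x_i f(e_i), which are C^k. *)
Lemma Ck_linear (m k : nat) (V : normedModType R)
    (f : {linear 'rV[R]_m -> V}) : Ck k f.
Proof.
have Cid : Ck k (@idfun 'rV[R]_m).
  case: k => [|k]; first by move=> x.
  split=> [x|v]; first exact: ex_diff.
  rewrite (_ : 'D_v _ = cst v); first exact: Ck_cst.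
  by apply/funext => x; exact: derive_id.
rewrite (_ : (f : _ -> _) =
    \sum_(i < m) (fun x : 'rV[R]_m => x 0 i *: f (delta_mx 0 i))).
  apply: Ck_sum => i; apply: (@Ck_scale _ _ _ _ (fun x : 'rV[R]_m => x 0 i)).
    exact: (Ck_coord i Cid).
  exact: Ck_cst.
apply/funext => x; rewrite fct_sumE [in LHS](row_sum_delta x) linear_sum.
by apply: eq_bigr => i _; rewrite linearZ.
Qed.

Lemma smooth_linear (m : nat) (V : normedModType R)
    (f : {linear 'rV[R]_m -> V}) : smooth f.
Proof. by move=> k; exact: Ck_linear. Qed.

Lemma smooth_differentiable (m : nat) (V : normedModType R)
    (f : 'rV[R]_m -> V) x : smooth f -> differentiable f x.
Proof. by move=> /(_ 1%N)[]. Qed.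

Lemma smooth_continuous (m : nat) (V : normedModType R)
    (f : 'rV[R]_m -> V) : smooth f -> continuous f.
Proof. by move=> /(_ 0%N). Qed.

Lemma smooth_derive (m : nat) (V : normedModType R) (f : 'rV[R]_m -> V) v :
  smooth f -> smooth ('D_v f).
Proof. by move=> sf k; have [_] := sf k.+1; exact. Qed.

(** The entries of the Jacobian are coordinates of partial derivatives of f,
    and those are smooth. *)
Lemma smooth_Jac (m n : nat) (f : 'rV[R]_m -> 'rV[R]_n) :
  smooth f -> smooth (Jac f).
Proof.
move=> sf; rewrite (_ : Jac f = \sum_(i < n) \sum_(j < m)
    (fun x => 'D_(delta_mx 0 j) f x 0 i *: delta_mx i j)).
  move=> k; apply: Ck_sum => i; apply: Ck_sum => j; apply: Ck_scale.
    exact: (Ck_coord i (smooth_derive (delta_mx 0 j) sf k)).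
  exact: Ck_cst.
apply/funext => x; rewrite fct_sumE [LHS]matrix_sum_delta.
apply: eq_bigr => i _; rewrite fct_sumE; apply: eq_bigr => j _.
rewrite deriveEjacobian; last exact: smooth_differentiable.
by rewrite -rowE !mxE.
Qed.

End smooth_maps.

(** * Measurability *)

Section measurability.
Variable R : realType.

(** For open U the limit f w lies in U iff, for some j, the points q k w
    eventually stay out of the open 1/(j+1)-neighbourhood of the complement of U;
    this is a countable combination of preimages of open sets. *)
Lemma measurable_borel_cvg d (T : measurableType d) (V : normedModType R)
    (q : nat -> T -> V) (f : T -> V) :
  (forall k, measurable_fun [set: T] (q k : T -> borel V)) ->
  (forall w, q ^~ w @ \oo --> f w) ->
  measurable_fun [set: T] (f : T -> borel V).
Proof.
move=> mq qf; apply: measurable_to_borel => U oU.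
pose S j := \bigcup_(z in ~` U) ball z (j.+1%:R^-1 : R).
have oS j : open (S j) by apply: bigcup_open => z _; exact: ball_open.
rewrite (_ : _ @^-1` _ = \bigcup_j \bigcup_N \bigcap_(k in [set k | (N <= k)%N])
    (q k @^-1` (~` S j))).
  apply: bigcupT_measurable => j; apply: bigcupT_measurable => N.
  apply: bigcap_measurableType => k _; rewrite -preimage_setC.
  by apply: measurableC; exact: measurable_borel_preimage.
apply/seteqP; split=> w /=.
  move=> Ufw; have /nbhs_ballP[e /= e0 eU] : nbhs (f w) U.
    exact: open_nbhs_nbhs.
  have e20 : 0 < e / 2 by rewrite divr_gt0.
  have [j _ /(_ j (leqnn _)) /= je] := near_infty_natSinv_lt (PosNum e20).
  have /cvg_ballP /(_ _ e20)[N _ NP] := qf w.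
  exists j => //; exists N => // k /= Nk [z Uz zq]; apply: Uz; apply: eU.
  have qz : ball (q k w) (e / 2) z by apply: ball_sym; exact: le_ball (ltW je) _ zq.
  by rewrite (splitr e); exact: ball_triangle (NP k Nk) qz.
move=> [j _ [N _ NP]]; apply: contrapT => Ufw.
have /cvg_ballP /(_ j.+1%:R^-1) := qf w.
rewrite invr_gt0 ltr0n => /(_ isT)[M _ MP].
apply: (NP (maxn N M)); first by rewrite /= leq_maxl.
by exists (f w) => //; apply: MP; rewrite /= leq_maxr.
Qed.

(** Freezing the second argument makes this an instance of the Caratheodory
    lemma, so that separate continuity of phi suffices and no comparison of the
    Borel sets of U * R^n with products of Borel sets is involved. *)
Lemma measurable_continuous2 d (T : measurableType d) (n : nat)
    (U V : normedModType R) (phi : U -> 'rV[R]_n -> V)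
    (f : T -> U) (g : T -> 'rV[R]_n) :
  (forall u, continuous (phi u)) -> (forall y, continuous (phi ^~ y)) ->
  measurable_fun [set: T] (f : T -> borel U) ->
  measurable_fun [set: T] (g : T -> borel 'rV[R]_n) ->
  measurable_fun [set: T] (fun w => phi (f w) (g w) : borel V).
Proof.
move=> c1 c2 mf mg.
apply: (measurable_caratheodory (p := fun u => phi (f u.2) u.1)) => //.
  by move=> w; exact: (c1 (f w)).
by move=> y; exact: measurableT_comp (continuous_measurable_borel (c2 y)) mf.
Qed.

End measurability.

(** * Calculus of mixed-smooth maps *)

Section mixed_smooth_calculus.
Variable R : realType.

Lemma mixed_smooth_comp (m n : nat) (V : normedModType R)
    (f : 'rV[R]_n -> V) (p : site R m -> 'rV[R]_n) :
  smooth f -> mixed_smooth p -> mixed_smooth (f \o p).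
Proof.
move=> sf [sp mp]; split=> [w|t]; first exact: smooth_comp (sp w).
apply: measurableT_comp (mp t).
by apply: continuous_measurable_borel; exact: smooth_continuous.
Qed.

Lemma mixed_smooth_smooth (m : nat) (V : normedModType R) (f : 'rV[R]_m -> V) :
  smooth f -> mixed_smooth (fun u : site R m => f u.1).
Proof. by move=> sf; split=> // t /=; exact: measurable_cst. Qed.

Lemma mixed_smoothD (m n : nat) (p q : site R m -> 'rV[R]_n) :
  mixed_smooth p -> mixed_smooth q -> mixed_smooth (fun u => p u + q u).
Proof.
move=> [sp mp] [sq mq]; split=> [w k|t]; first exact: CkD (sp w k) (sq w k).
apply: (measurable_continuous2 (phi := fun u y : 'rV[R]_n => u + y)) => //.
  by move=> u y; apply: continuousD => //; exact: cst_continuous.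
by move=> y u; apply: continuousD => //; exact: cst_continuous.
Qed.

Lemma mixed_smoothZ (m n : nat) (a : site R m -> R^o)
    (q : site R m -> 'rV[R]_n) :
  mixed_smooth a -> mixed_smooth q -> mixed_smooth (fun u => a u *: q u).
Proof.
move=> [sa ma] [sq mq]; split=> [w k|t].
  exact: Ck_scale (sa w k) (sq w k).
apply: (measurable_continuous2 (phi := fun (u : R^o) (y : 'rV[R]_n) => u *: y)) => //.
  by move=> u y; exact: scaler_continuous.
by move=> y u; exact: scalel_continuous.
Qed.

(** The derivative is a limit over the punctured neighbourhoods of 0; this
    sequence turns it into a countable limit. *)
Lemma harmonic_dnbhs : @harmonic R @ \oo --> (0 : R)^'.
Proof.
move=> P /(@cvg_harmonic R)[N _ NP]; exists N => // k Nk; apply: (NP k Nk).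
by apply: lt0r_neq0; exact: harmonic_gt0.
Qed.

(** Measurability in the sample survives differentiation because the derivative
    is the pointwise limit of the difference quotients of steps 1/(k+1). *)
Lemma mixed_smooth_derive (m n : nat) (p : site R m -> 'rV[R]_n) v :
  mixed_smooth p -> mixed_smooth (fun u => 'D_v (fun t => p (t, u.2)) u.1).
Proof.
move=> [sp mp]; split=> [w|t /=]; first exact: smooth_derive (sp w).
pose q k w := (harmonic k)^-1 *: (p (harmonic k *: v + t, w) - p (t, w)).
apply: (measurable_borel_cvg (q := q)) => [k|w].
  have mB : measurable_fun [set: Omega R]
      (fun w => p (harmonic k *: v + t, w) - p (t, w) : borel 'rV[R]_n).
    apply: (measurable_continuous2 (phi := fun u y : 'rV[R]_n => u - y)) => //.
      by move=> u y; apply: continuousB => //; exact: cst_continuous.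
    by move=> y u; apply: continuousB => //; exact: cst_continuous.
  have cZ : continuous ( *:%R (harmonic k)^-1 : 'rV[R]_n -> _).
    exact: scaler_continuous.
  exact: measurableT_comp (continuous_measurable_borel cZ) mB.
have /diff_derivable-/(_ v) /cvg_ex[l dl] := smooth_differentiable t (sp w).
rewrite (_ : 'D_v _ _ = l); last exact: cvg_lim dl.
exact: cvg_comp harmonic_dnbhs dl.
Qed.

End mixed_smooth_calculus.

(** * Tangent coordinates of R^n *)

Section euclidean_spaces.
Variable R : realType.

(** The tautological plot (t, w) |-> t of R^m detects smoothness. *)
Lemma sample_smoothP (m : nat) (V : normedModType R) (f : 'rV[R]_m -> V) :
  @sample_smooth R (Rn R m) (euclid V) f <-> smooth f.
Proof.
split=> [sf|sf n p]; last exact: mixed_smooth_comp.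
have [sp _] := sf m fst (mixed_smooth_smooth (smooth_linear idfun)).
exact: (sp point).
Qed.

Lemma smooth_coord (m : nat) (i : 'I_m) :
  @smooth R m R^o (fun x => x 0 i).
Proof. by move=> k; exact: (Ck_coord i (Ck_linear k idfun)). Qed.

Lemma site_mor_smooth (m n : nat) (f : 'rV[R]_m -> 'rV[R]_n) :
  smooth f -> site_mor (fun u : site R m => (f u.1, u.2)).
Proof.
move=> sf; exists (fun u => f u.1), id; split => //.
exact: mixed_smooth_smooth.
Qed.

Lemma site_mor_id (m : nat) : site_mor (@id (site R m)).
Proof.
rewrite (_ : id = fun u : site R m => (idfun u.1, u.2)); last first.
  by apply/funext => -[].
exact: (site_mor_smooth (smooth_linear idfun)).
Qed.

(** The real line is reached only through plots, so the curve is first composed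
    with the coordinate plot of R^1. *)
Lemma curve_differentiable (n : nat) (c : curve (Rn R n)) (t : R) :
  differentiable (c : R -> 'rV[R]_n) t.
Proof.
have pc : plot (line R) 1 (fun u => u.1 0 0).
  exact: (mixed_smooth_smooth (smooth_coord 0)).
have [/(_ point) sc _] := sss_funP c pc.
rewrite (_ : (c : R -> 'rV[R]_n) = (fun x : 'rV[R]_1 => c (x 0 0)) \o
    (fun s : R => s *: (const_mx 1 : 'rV[R]_1))); last first.
  by apply/funext => s /=; rewrite !mxE mulr1.
apply: differentiable_comp; last exact: smooth_differentiable sc.
by have [dt _] := is_diff_scalel t (const_mx 1 : 'rV[R]_1); exact: dt.
Qed.

Definition velocity (n : nat) (c : curve (Rn R n)) : 'rV[R]_n :=
  derive1 (fun t : R => c t : 'rV[R]_n) 0.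

Lemma derive1_curve (n : nat) (V : normedModType R) (f : 'rV[R]_n -> V)
    (c : curve (Rn R n)) :
  smooth f ->
  derive1 (fun t : R => f (c t)) 0 = 'd f (c (0 : R)) (velocity c).
Proof.
move=> sf; have dc := curve_differentiable c 0.
have df := smooth_differentiable (c (0 : R)) sf.
rewrite /velocity !derive1E' //; last exact: (differentiable_comp dc df).
by rewrite (diff_comp dc df).
Qed.

(** Coordinate functions recover the velocity; conversely the chain rule shows
    that no smooth function sees more than base point and velocity. *)
Lemma tangent_eqP (n : nat) (c d : curve (Rn R n)) :
  tangent_eq c d <-> c (0 : R) = d (0 : R) /\ velocity c = velocity d.
Proof.
split=> [[e0 e1]|[e0 e1]]; split=> //; last first.
  move=> f; have sf : smooth f by apply/sample_smoothP; exact: sss_funP.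
  by rewrite !(derive1_curve _ sf) e0 e1.
apply/rowP => i; have /sample_smoothP sf := @smooth_coord n i.
have := e1 (SSSMor sf); rewrite /velocity !derive1E /=.
by rewrite !derive_mx ?mxE//; apply: diff_derivable; exact: curve_differentiable.
Qed.

(** Uncurrying: the parameter of the curves becomes an additional Euclidean
    coordinate of the site, and the velocity becomes a partial derivative. *)
Lemma mixed_smooth_velocity (n k : nat) (P : site R k -> curve (Rn R n)) :
  plot (curve (Rn R n)) k P -> mixed_smooth (fun u => velocity (P u)).
Proof.
move=> sP.
pose g (u : site R (k + 1)) := P (lsubmx u.1, u.2) (rsubmx u.1 0 0).
have sg : mixed_smooth g.
  apply: (sP _ (fun u => (lsubmx u.1, u.2)) (fun u => rsubmx u.1 0 0)).
    exact: (site_mor_smooth (smooth_linear lsubmx)).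
  apply: (@mixed_smooth_smooth R _ R^o (fun x => rsubmx x 0 0)) => l.
  exact: (Ck_coord 0 (Ck_linear l rsubmx)).
pose v : 'rV[R]_(k + 1) := row_mx 0 (const_mx 1).
have sr : smooth (fun x : 'rV[R]_k => row_mx x (0 : 'rV[R]_1)).
  rewrite (_ : (fun _ => _) = mulmxr (row_mx 1%:M 0)); first exact: smooth_linear.
  by apply/funext => x /=; rewrite mul_mx_row mulmx1 mulmx0.
(* The derivative along the added coordinate, evaluated where it vanishes. *)
have := mixed_smooth_site (mixed_smooth_derive v sg) (site_mor_smooth sr).
congr mixed_smooth; apply/funext => -[x w] /=.
rewrite /velocity /derive1 /derive.
set d := (fun _ : R => _); set d' := (fun _ : R => _).
suff -> : d = d' by [].
apply/funext => h; rewrite /d /d' /g /= scale_row_mx scaler0 add_row_mx.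
by rewrite !row_mxKl !row_mxKr !mxE add0r mulr1.
Qed.

Lemma mixed_smooth_base (n k : nat) (P : site R k -> curve (Rn R n)) :
  plot (curve (Rn R n)) k P ->
  mixed_smooth (fun u => P u (0 : R) : 'rV[R]_n).
Proof.
move=> sP; apply: (sP k id (fun=> (0 : R))); first exact: site_mor_id.
exact: (@plot_cst R (line R) k (0 : R)).
Qed.

Definition tcoord_fun (n : nat) (xi : tangent (Rn R n)) :
    sss_prod (Rn R n) (Rn R n) :=
  (trepr xi (0 : R), velocity (trepr xi)).

Lemma tcoord_funE (n : nat) (c : curve (Rn R n)) :
  tcoord_fun (tclass c) = (c (0 : R), velocity c).
Proof.
have /tclass_eq/tangent_eqP[e0 e1] := treprK (tclass c).
by rewrite /tcoord_fun e0 e1.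
Qed.

Lemma tcoord_fun_smooth (n : nat) : sample_smooth (@tcoord_fun n).
Proof.
move=> k r [[xi ->]|[P sP ->]]; first exact: plot_cst.
split.
  rewrite (_ : _ \o _ = (fun u => P u (0 : R) : 'rV[R]_n)).
    exact: mixed_smooth_base.
  by apply/funext => u; exact: (congr1 fst (tcoord_funE (P u))).
rewrite (_ : _ \o _ = (fun u => velocity (P u))).
  exact: mixed_smooth_velocity.
by apply/funext => u; exact: (congr1 snd (tcoord_funE (P u))).
Qed.

Definition tcoord (n : nat) :
    sss_mor (tangent (Rn R n)) (sss_prod (Rn R n) (Rn R n)) :=
  SSSMor (@tcoord_fun_smooth n).

Lemma straight_plot (n k : nat) (p q : site R k -> 'rV[R]_n) (a : site R k -> R) :
  mixed_smooth p -> mixed_smooth q -> mixed_smooth (a : _ -> R^o) ->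
  mixed_smooth (fun u => p u + a u *: q u).
Proof.
by move=> sp sq sa; apply: mixed_smoothD => //; exact: mixed_smoothZ.
Qed.

Lemma straight_smooth (n : nat) (x v : 'rV[R]_n) :
  @sample_smooth R (line R) (Rn R n) (fun t : R => x + t *: v).
Proof.
by move=> k a sa; apply: (straight_plot _ _ sa); exact: mixed_smooth_cst.
Qed.

Definition straight (n : nat) (x v : 'rV[R]_n) : curve (Rn R n) :=
  SSSMor (straight_smooth x v).

Lemma straight0 (n : nat) (x v : 'rV[R]_n) : straight x v (0 : R) = x.
Proof. by rewrite /= scale0r addr0. Qed.

Lemma velocity_straight (n : nat) (x v : 'rV[R]_n) :
  velocity (straight x v) = v.
Proof.
apply: cvg_lim => //; apply: cvg_near_cst; near=> h.
have h0 : h != 0 by near: h; exact: nbhs_dnbhs_neq.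
by rewrite /= scale0r !addr0 addrAC subrr add0r scalerA mulVf ?scale1r.
Unshelve. all: by end_near. Qed.

Lemma tclass_straight_smooth (n : nat) :
  @sample_smooth R (sss_prod (Rn R n) (Rn R n)) (tangent (Rn R n))
    (fun xv => tclass (straight xv.1 xv.2)).
Proof.
move=> k r [s1 s2]; right; exists (fun u => straight (r u).1 (r u).2) => //.
move=> m h q sh sq; apply: straight_plot => //.
  exact: (mixed_smooth_site s1 sh).
exact: (mixed_smooth_site s2 sh).
Qed.

Lemma tcoord_iso (n : nat) : is_iso (tcoord n).
Proof.
exists (SSSMor (@tclass_straight_smooth n)); split=> [xi|[x v]].
  rewrite -[RHS]treprK; apply/tclass_eq/tangent_eqP.
  by rewrite straight0 velocity_straight.
by rewrite /= [LHS]tcoord_funE straight0 velocity_straight.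
Qed.

End euclidean_spaces.

(** * Functoriality of the tangent bundle *)

Section tangent_functor.
Variable R : realType.
Implicit Types X Y Z : sss R.

Lemma sample_smooth_id X : @sample_smooth R X X id.
Proof. by []. Qed.

Definition sss_id X : sss_mor X X := SSSMor (@sample_smooth_id X).

Lemma tmap_comp X Y Z (g : sss_mor Y Z) (f : sss_mor X Y) xi :
  tmap g (tmap f xi) = tmap (sss_comp g f) xi.
Proof.
rewrite -(treprK xi) /= !tmap_funE; congr tclass; exact: sss_mor_ext.
Qed.

Lemma eq_tmap X Y (f g : sss_mor X Y) : f =1 g -> tmap f = tmap g.
Proof. by move=> fg; congr tmap; exact: sss_mor_ext. Qed.

Lemma tmap_id X xi : tmap (sss_id X) xi = xi.
Proof.
by rewrite -[RHS]treprK -[in LHS](treprK xi) /= tmap_funE; congr tclass;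
  exact: sss_mor_ext.
Qed.

Lemma is_iso_tmap X Y (f : sss_mor X Y) : is_iso f -> is_iso (tmap f).
Proof.
move=> [g [fK gK]]; exists (tmap g); split=> xi; rewrite tmap_comp.
  by rewrite (@eq_tmap _ _ _ (sss_id _)) ?tmap_id.
by rewrite (@eq_tmap _ _ _ (sss_id _)) ?tmap_id.
Qed.

Lemma is_iso_comp X Y Z (g : sss_mor Y Z) (f : sss_mor X Y) :
  is_iso g -> is_iso f -> is_iso (sss_comp g f).
Proof.
move=> [g' [gK g'K]] [f' [fK f'K]]; exists (sss_comp f' g').
by split; [exact: can_comp gK fK|exact: can_comp f'K g'K].
Qed.

End tangent_functor.

(** * Fibres, tangent maps and charts *)

Section tangent_of_euclidean.
Variable R : realType.

Lemma fiber_coord_smooth (n : nat) (x : Rn R n) :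
  @sample_smooth R (tfiber x) (Rn R n) (fun xi => (tcoord R n (sval xi)).2).
Proof. by move=> k p sp; have [] := sss_funP (tcoord R n) sp. Qed.

Lemma fiber_straight (n : nat) (x : Rn R n) (v : 'rV[R]_n) :
  [set xi : tangent (Rn R n) | tproj xi = x] (tclass (straight x v)).
Proof. by rewrite /= tprojE straight0. Qed.

Lemma fiber_straight_smooth (n : nat) (x : Rn R n) :
  @sample_smooth R (Rn R n) (tfiber x)
    (fun v => exist _ _ (fiber_straight x v)).
Proof.
move=> k p sp; apply: (tclass_straight_smooth (p := fun u => (x, p u))).
by split; first exact: plot_cst.
Qed.

Lemma fiber_iso (n : nat) (x : Rn R n) :
  is_iso (SSSMor (@fiber_coord_smooth n x)).
Proof.
exists (SSSMor (@fiber_straight_smooth n x)); split=> [[xi xix]|v] /=.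
  apply: eq_exist => /=; rewrite -[RHS]treprK; apply/tclass_eq/tangent_eqP.
  by rewrite straight0 velocity_straight.
rewrite -[RHS](velocity_straight x v).
exact: (congr1 snd (tcoord_funE (straight x v))).
Qed.

(** The chain rule, read on a representing curve. *)
Lemma tcoord_tmap (m n : nat) (f : sss_mor (Rn R m) (Rn R n))
    (xi : tangent (Rn R m)) (x v : 'rV[R]_m) :
  tcoord R m xi = (x, v) ->
  tcoord R n (tmap f xi) = (f x, 'D_v (f : 'rV[R]_m -> 'rV[R]_n) x).
Proof.
have sf : smooth (f : 'rV[R]_m -> 'rV[R]_n).
  by apply/sample_smoothP; exact: sss_funP.
rewrite -(treprK xi); set c := trepr xi.
rewrite [LHS]tcoord_funE => -[<- <-].
rewrite /= tmap_funE [LHS]tcoord_funE; congr pair.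
rewrite /velocity /= derive1_curve// deriveE//; exact: smooth_differentiable.
Qed.

Lemma JacE (m n : nat) (f : 'rV[R]_m -> 'rV[R]_n) (x v : 'rV[R]_m) :
  differentiable f x -> (Jac f x *m v^T)^T = 'D_v f x.
Proof. by move=> df; rewrite trmx_mul !trmxK deriveEjacobian. Qed.

(** Concatenation is the sum of two linear embeddings. *)
Lemma row_pair_smooth (m n : nat) :
  @sample_smooth R (sss_prod (Rn R m) (Rn R n)) (Rn R (m + n))
    (fun z => row_mx z.1 z.2).
Proof.
move=> k p [s1 s2].
rewrite (_ : _ \o _ = fun u => mulmxr (row_mx 1%:M 0) (p u).1 +
                               mulmxr (row_mx 0 1%:M) (p u).2).
  apply: mixed_smoothD.
    exact: (mixed_smooth_comp (smooth_linear (mulmxr (row_mx 1%:M 0))) s1).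
  exact: (mixed_smooth_comp (smooth_linear (mulmxr (row_mx 0 1%:M))) s2).
apply/funext => u /=.
by rewrite !mul_mx_row !mulmx1 !mulmx0 add_row_mx addr0 add0r.
Qed.

Definition row_pair (m n : nat) :
    sss_mor (sss_prod (Rn R m) (Rn R n)) (Rn R (m + n)) :=
  SSSMor (@row_pair_smooth m n).

Lemma row_split_smooth (m n : nat) :
  @sample_smooth R (Rn R (m + n)) (sss_prod (Rn R m) (Rn R n))
    (fun z => (lsubmx z, rsubmx z)).
Proof.
move=> k p sp; split.
  exact: (mixed_smooth_comp (smooth_linear lsubmx) sp).
exact: (mixed_smooth_comp (smooth_linear rsubmx) sp).
Qed.

Lemma row_pair_iso (m n : nat) : is_iso (row_pair m n).
Proof.
exists (SSSMor (@row_split_smooth m n)); split=> [[x y]|z] /=.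
  by rewrite row_mxKl row_mxKr.
by rewrite hsubmxK.
Qed.

Fixpoint chart (n k : nat) : sss_mor (iter_tangent k (Rn R n)) (Rn R (tdim n k)) :=
  if k is k'.+1 return sss_mor (iter_tangent k (Rn R n)) (Rn R (tdim n k)) then
    sss_comp (row_pair _ _) (sss_comp (tcoord R _) (tmap (chart n k')))
  else sss_id _.

Lemma chart_iso (n k : nat) : is_iso (chart n k).
Proof.
elim: k => [|k IH]; first by exists (sss_id _).
apply: is_iso_comp; first exact: row_pair_iso.
by apply: is_iso_comp; [exact: tcoord_iso|exact: is_iso_tmap].
Qed.

End tangent_of_euclidean.

(** * Iterated tangent maps *)

Section iterated_derivatives.
Variable R : realType.

(** The k-fold tangent map of f in the coordinates of the charts. *)
Fixpoint prolong (m n k : nat) (f : 'rV[R]_m -> 'rV[R]_n) :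
    'rV[R]_(tdim m k) -> 'rV[R]_(tdim n k) :=
  if k is k'.+1 return 'rV[R]_(tdim m k) -> 'rV[R]_(tdim n k) then
    fun z => row_mx (prolong f (lsubmx z))
                    ('D_(rsubmx z) (@prolong m n k' f) (lsubmx z))
  else f.

(** Charts are isomorphisms, so G is the composite of a chart, the k-fold
    tangent map and an inverse chart, all of them sample-smooth. *)
Lemma chart_conj_smooth (m n k : nat) (f : sss_mor (Rn R m) (Rn R n))
    (G : 'rV[R]_(tdim m k) -> 'rV[R]_(tdim n k)) :
  (forall xi, chart R n k (iter_tmap k f xi) = G (chart R m k xi)) ->
  @sample_smooth R (Rn R _) (Rn R _) G.
Proof.
move=> GE; have [g [_ gK]] := chart_iso R m k.
rewrite (_ : G = sss_comp (chart R n k) (sss_comp (iter_tmap k f) g)).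
  exact: sss_funP.
by apply/funext => z /=; rewrite GE gK.
Qed.

(** By functoriality T^(k+1) f is, in the charts of level k, the tangent map of
    the prolongation of order k, to which the formula for tangent maps applies. *)
Lemma chart_iter_tmap (m n k : nat) (f : sss_mor (Rn R m) (Rn R n))
    (xi : iter_tangent k (Rn R m)) :
  chart R n k (iter_tmap k f xi) = prolong f (chart R m k xi).
Proof.
elim: k xi => [//|k IH] xi.
have sF := chart_conj_smooth IH.
pose F : sss_mor (Rn R _) (Rn R _) := SSSMor sF.
have FE : tmap (chart R n k) (tmap (iter_tmap k f) xi) =
    tmap F (tmap (chart R m k) xi).
  by rewrite !tmap_comp (@eq_tmap _ _ _ _ (sss_comp F (chart R m k))).
have := @tcoord_tmap R _ _ F (tmap (chart R m k) xi).
case E : (tcoord R _ (tmap (chart R m k) xi)) => [y w] /(_ _ _ erefl).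
rewrite -FE => FyE.
have -> : chart R m k.+1 xi = row_mx y w by exact: (congr1 (row_pair _ _ _) E).
rewrite /= row_mxKl row_mxKr.
exact: (congr1 (row_pair _ _ _) FyE).
Qed.

(** Only the base-point coordinates of the jet point depend on x; the shape
    h u + x is the one occurring in the definition of directional derivatives. *)
Lemma jet_point_affine (n k : nat) (x u : 'rV[R]_n) (v : nat -> 'rV[R]_n) h :
  jet_point k (h *: u + x) v = h *: base_vec k u + jet_point k x v.
Proof.
elim: k => [//|k IH] /=.
by rewrite IH scale_row_mx scaler0 add_row_mx add0r.
Qed.

Lemma top_part_linear (n k : nat) : linear (@top_part R n k).
Proof. by elim: k => [//|k IH] a u v /=; rewrite linearP IH. Qed.

HB.instance Definition _ (n k : nat) :=
  GRing.isLinear.Build R _ _ _ (@top_part R n k) (@top_part_linear n k).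

(** J maps each line in direction u to a line in direction w, so the difference
    quotients of the composite are the images under T of those of G. *)
Lemma derive_affine (a b p q : nat) (T : {linear 'rV[R]_b -> 'rV[R]_q})
    (G : 'rV[R]_a -> 'rV[R]_b) (J : 'rV[R]_p -> 'rV[R]_a) x u w :
  (forall h : R, J (h *: u + x) = h *: w + J x) -> derivable G (J x) w ->
  'D_u (T \o G \o J) x = T ('D_w G (J x)).
Proof.
move=> JE dG; apply: cvg_lim => //.
rewrite (_ : (fun _ => _) =
    T \o (fun h => h^-1 *: ((G \o shift (J x)) (h *: w) - G (J x)))).
  apply: (cvg_comp _ _ dG).
  exact: smooth_continuous (smooth_linear T) _.
by apply/funext => h; rewrite /= JE linearZ (linearB T).
Qed.

Lemma prolong_smooth (m n k : nat) (f : 'rV[R]_m -> 'rV[R]_n) :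
  smooth f -> smooth (prolong (k := k) f).
Proof.
move=> /sample_smoothP sf; apply/sample_smoothP.
exact: (chart_conj_smooth (chart_iter_tmap (SSSMor sf))).
Qed.

(** Passing from k to k + 1 differentiates the prolongation of order k along the
    base vector of v_k, which is the same as differentiating in x along v_k. *)
Lemma prolong_jet_point (m n k : nat) (f : 'rV[R]_m -> 'rV[R]_n)
    (x : 'rV[R]_m) (v : nat -> 'rV[R]_m) :
  smooth f -> top_part (prolong f (jet_point k x v)) = iter_derive k f v x.
Proof.
move=> sf; elim: k x => [//|k IH] x /=.
rewrite !row_mxKl !row_mxKr.
rewrite -(@derive_affine _ _ _ _ _ _ (fun y => jet_point k y v) x (v k)).
- by congr ('D_(v k) _ x); apply/funext => y; rewrite -IH.
- by move=> h; exact: jet_point_affine.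
- by apply: diff_derivable; apply: smooth_differentiable; exact: prolong_smooth.
Qed.

End iterated_derivatives.

Theorem theorem4p35 (R : realType) :
  exists Phi : forall n : nat,
    sss_mor (tangent (Rn R n)) (sss_prod (Rn R n) (Rn R n)),
  [/\ forall (n : nat) (c : curve (Rn R n)),
        Phi n (tclass c) = (c (0 : R), derive1 (fun t : R => c t : 'rV[R]_n) 0),
      forall n : nat, is_iso (Phi n),
      forall (n : nat) (x : Rn R n),
        exists2 psi : sss_mor (tfiber x) (Rn R n),
          (forall xi : tfiber x, Phi n (sval xi) = (x, psi xi)) & is_iso psi
    & [/\ forall (m n : nat) (f : 'rV[R]_m -> 'rV[R]_n),
            @sample_smooth R (Rn R m) (Rn R n) f <-> smooth f,
          forall (m n : nat) (f : sss_mor (Rn R m) (Rn R n))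
              (xi : tangent (Rn R m)) (x v : 'rV[R]_m),
            Phi m xi = (x, v) ->
            Phi n (tmap f xi) = (f x, (Jac f x *m v^T)^T),
          forall (m n : nat) (f : sss_mor (Rn R m) (Rn R n)),
            @sample_smooth R (Rn R m) (Mat R n m) (Jac f)
        & exists chart : forall n k : nat,
            sss_mor (iter_tangent k (Rn R n)) (Rn R (tdim n k)),
          [/\ forall (n : nat) (x : Rn R n), chart n 0%N x = x,
              forall (n k : nat) (xi : iter_tangent k.+1 (Rn R n)),
                chart n k.+1 xi =
                  row_mx (Phi (tdim n k) (tmap (chart n k) xi)).1
                         (Phi (tdim n k) (tmap (chart n k) xi)).2,
              forall n k : nat, is_iso (chart n k)
            & forall (m n k : nat) (f : sss_mor (Rn R m) (Rn R n))
                  (x : 'rV[R]_m) (v : nat -> 'rV[R]_m)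
                  (xi : iter_tangent k (Rn R m)),
                chart m k xi = jet_point k x v ->
                top_part (chart n k (iter_tmap k f xi)) = iter_derive k f v x]]].
Proof.
have sf m n (f : sss_mor (Rn R m) (Rn R n)) : smooth (f : 'rV[R]_m -> 'rV[R]_n).
  by apply/sample_smoothP; exact: sss_funP.
exists (@tcoord R); split=> [n c|n|n x|].
- exact: tcoord_funE.
- exact: tcoord_iso.
- exists (SSSMor (@fiber_coord_smooth R n x)); last exact: fiber_iso.
  by move=> [xi xix]; rewrite [LHS]surjective_pairing; congr pair.
split=> [m n f|m n f xi x v xiE|m n f|].
- exact: sample_smoothP.
- rewrite (tcoord_tmap f xiE) JacE//; apply: smooth_differentiable.
  exact: sf.
- by apply/sample_smoothP; apply: smooth_Jac; exact: sf.
exists (@chart R); split=> [//|//|n k|m n k f x v xi xiE].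
  exact: chart_iso.
rewrite chart_iter_tmap xiE; apply: prolong_jet_point; exact: sf.
Qed.
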